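(* Let $f\colon \mathbb{R}\to\mathbb{R}_{>0}$ and $h\colon \mathbb{R}\to\mathbb{R}_{>0}$ be functions such that $h$ is non-decreasing and $h(x)=o(x\log\log x)$ as $x\to\infty$. Then there exists a graph $G$ such that \[ {\rm tw}(G) > h({\rm tree}\text{-}\alpha(G))\cdot f({\rm tree}\text{-}\chi(G)). \]
   Context: All graphs are finite and simple. A tree-decomposition of a graph $G$ is a pair $(T,\{X_t\}_{t\in V(T)})$ where $T$ is a tree and $X_t\subseteq V(G)$ for each node $t$, such that every edge $uv$ of $G$ has both ends in some $X_t$, and for every vertex $v$ the set $\{t: v\in X_t\}$ induces a non-empty connected subtree of $T$. ${\rm tw}(G)$ (treewidth) is the minimum over all tree-decompositions of $\max_t |X_t| - 1$. For a graph parameter $p$, ${\rm tree}\text{-}p(G)$ is the minimum over all tree-decompositions of $G$ of $\max_{t} p(G[X_t])$. In particular ${\rm tree}\text{-}\alpha(G)$ uses the independence number $\alpha$ (maximum size of a set of pairwise non-adjacent vertices), and ${\rm tree}\text{-}\chi(G)$ uses the chromatic number $\chi$. *)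

(* Defs.v *)
From HB Require Import structures.
From mathcomp Require Import all_boot all_order all_algebra.
From mathcomp Require Import all_classical all_reals all_analysis.
Import Order.TTheory GRing.Theory Num.Theory.
Import numFieldNormedType.Exports.

Set Implicit Arguments.
Unset Strict Implicit.
Unset Printing Implicit Defensive.

(* Makes [+oo_R] usable as the filter of the Landau notations. *)
Canonical pinfty_nbhs_filter_on (R : numFieldType) : filter_on R :=
  FilterType (pinfty_nbhs R) _.

Record sgraph := SGraph {
  vertex :> finType;
  edge : rel vertex;
  edge_sym : symmetric edge;
  edge_irrefl : irreflexive edge }.

Arguments edge {_} _ _.

Section Graphs.
Variable G : sgraph.

Section Induced.
Variable X : {set G}.

Definition induced_edge : rel {x : G | x \in X} :=
  fun u v => edge (val u) (val v).

Fact induced_sym : symmetric induced_edge.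
Proof. by move=> u v; apply: edge_sym. Qed.

Fact induced_irrefl : irreflexive induced_edge.
Proof. by move=> u; apply: edge_irrefl. Qed.

Definition induced : sgraph := SGraph induced_sym induced_irrefl.
End Induced.

(* The graph with no vertices is not connected. *)
Definition is_connected : Prop :=
  (0 < #|G|)%N /\ forall u v : G, connect edge u v.

(* [ucycle] alone also accepts the sequences [::] and [:: u; v] with
   [edge u v], hence the bound on the size. *)
Definition is_acyclic : Prop :=
  forall c : seq G, (2 < size c)%N -> ~ ucycle edge c.

Definition is_tree : Prop := is_connected /\ is_acyclic.

Definition independent (A : {set G}) : bool :=
  [forall u in A, forall v in A, ~~ edge u v].

Definition independence_number : nat :=
  \max_(A : {set G} | independent A) #|A|.

Definition colorable (k : nat) : bool :=
  [exists c : {ffun G -> 'I_k}, forall u, forall v, edge u v ==> (c u != c v)].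

Fact colorable_exists : exists k, colorable k.
Proof.
exists #|G|; apply/existsP; exists [ffun u => enum_rank u].
apply/forallP => u; apply/forallP => v; apply/implyP => uv.
rewrite !ffunE; apply/eqP => /enum_rank_inj uv_eq.
by rewrite uv_eq edge_irrefl in uv.
Qed.

Definition chromatic_number : nat := ex_minn colorable_exists.

End Graphs.

Record tree_decomposition (G : sgraph) := TreeDecomposition {
  td_graph :> sgraph;
  td_tree : is_tree td_graph;
  bag : td_graph -> {set G};
  bag_edge : forall u v : G, edge u v ->
    exists t, (u \in bag t) && (v \in bag t);
  bag_connected : forall v : G, is_connected (induced [set t | v \in bag t]) }.

Section TrivialDecomposition.
Variable G : sgraph.

Let one_edge : rel unit := fun _ _ => false.

Let one_sym : symmetric one_edge. Proof. by []. Qed.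

Let one_irrefl : irreflexive one_edge. Proof. by []. Qed.

Let one_node : sgraph := SGraph one_sym one_irrefl.

Fact one_node_tree : is_tree one_node.
Proof.
split; first by split=> [|[] []]; rewrite ?card_unit ?connect0.
by case=> [|u [|v [|w c]]].
Qed.

Fact one_bag_edge (u v : G) : edge u v ->
  exists t : one_node, (u \in [set: G]) && (v \in [set: G]).
Proof. by exists tt; rewrite !inE. Qed.

Fact one_bag_connected (v : G) :
  is_connected (induced [set t : one_node | v \in [set: G]]).
Proof.
have tt_in : tt \in [set t : one_node | v \in [set: G]] by rewrite !inE.
split; first by apply/card_gt0P; exists (Sub tt tt_in).
move=> s t; suff -> : s = t by rewrite connect0.
by apply: val_inj; case: (val s); case: (val t).
Qed.

Definition trivial_decomposition : tree_decomposition G :=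
  TreeDecomposition one_node_tree one_bag_edge one_bag_connected.
End TrivialDecomposition.

Section Width.
Variables (G : sgraph) (w : {set G} -> nat).

Definition bag_max (D : tree_decomposition G) : nat := \max_(t : D) w (bag t).

Definition is_bag_max (k : nat) : bool :=
  `[< exists D : tree_decomposition G, bag_max D = k >].

Fact is_bag_max_exists : exists k, is_bag_max k.
Proof.
by exists (bag_max (trivial_decomposition G)); apply/asboolP; eexists.
Qed.

Definition min_bag_max : nat := ex_minn is_bag_max_exists.
End Width.

(* Integer-valued: the graph with no vertices has treewidth -1. *)
Definition treewidth (G : sgraph) : int :=
  ((min_bag_max (fun X : {set G} => #|X|))%:Z - 1)%R.

Definition tree_parameter (p : sgraph -> nat) (G : sgraph) : nat :=
  min_bag_max (fun X : {set G} => p (induced X)).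

Notation tree_alpha := (tree_parameter independence_number).
Notation tree_chi := (tree_parameter chromatic_number).

(* Main.v *)
(* The Burling graphs G_k have a tree decomposition with bipartite bags, yet they carry
   weights of total at least (k + 2) / 2 times that of any stable set, where the
   maximal weight of a stable set is at most 2^(2^k) / 2. Blowing up the vertices
   according to the weights gives a graph H with (k + 2) 2^(2^k) / 4 vertices and
   independence number at most 2^(2^k) / 2. Now take a central copy of H, and |H| leaf
   copies, each with a hub adjacent to all its vertices, and join every vertex of a
   leaf copy to its twin in the central copy. Bags made of the central copy and one
   leaf copy keep tree-alpha at most 2 alpha(H) + 1; bags made of all twins of a bag
   of H, together with the hubs, keep tree-chi at most 5. But contracting the leaf
   copies gives a complete bipartite graph between |H| and |H| vertices, so that the
   treewidth is about |H|, which exceeds tree-alpha by a factor of order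
   log log tree-alpha. *)
Require Import Defs.
From mathcomp Require Import all_boot all_order all_algebra.
From mathcomp Require Import zify ring lra.
From mathcomp Require Import all_classical all_reals all_analysis.
Import Order.TTheory GRing.Theory Num.Theory.
Import numFieldNormedType.Exports.

Set Implicit Arguments.
Unset Strict Implicit.
Unset Printing Implicit Defensive.

(** * Connectivity inside a set of vertices *)

Definition rel_within (T : finType) (e : rel T) (A : pred T) : rel T :=
  [rel x y | [&& A x, A y & e x y]].

Lemma rel_within_connect_sym (T : finType) (e : rel T) (A : pred T) :
  symmetric e -> connect_sym (rel_within e A).
Proof.
by move=> sym_e; apply: sym_connect_sym => x y; rewrite /rel_within /= sym_e andbCA.
Qed.

(** Walks of the subtype are traded for walks of [G] confined to [X], whose vertices carry no
    membership proof. *)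
Lemma is_connected_induced (G : sgraph) (X : {set G}) :
  is_connected (Defs.induced X) <->
  (exists x, x \in X) /\
  {in X &, forall x y, connect (rel_within edge (mem X)) x y}.
Proof.
split=> [[/card_gt0P[x _] conn]|[[x Xx] conn]].
  split; first by exists (val x); apply: valP.
  suff lift_conn (s t : Defs.induced X) :
      connect edge s t -> connect (rel_within edge (mem X)) (val s) (val t).
    by move=> u v Xu Xv; apply: (lift_conn (Sub u Xu) (Sub v Xv) (conn _ _)).
  case/connectP=> p + ->; elim: p s => [|r p IHp] s /=; first by rewrite connect0.
  case/andP=> sr rp; apply: connect_trans (IHp r rp); apply: connect1.
  by rewrite /rel_within /= (valP s) (valP r).
split; first by apply/card_gt0P; exists (Sub x Xx).
move=> u v; have /connectP[p] := conn _ _ (valP u) (valP v).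
elim: p u => [|w p IHp] u /=; first by move=> _ /val_inj ->.
case/andP=> /and3P[_ Xw uw] wp last_p.
apply: connect_trans (IHp (Sub w Xw) wp last_p).
exact: connect1.
Qed.

(** * Trees and tree-decompositions given by a parent map *)

Section RootedTree.
Variables (T : finType) (parent : T -> T) (rank : T -> nat) (root : T).
Hypothesis parent_root : parent root = root.
Hypothesis rank_parent : forall x, x != root -> rank (parent x) < rank x.

Definition rooted_edge : rel T :=
  [rel x y | (x != y) && ((parent x == y) || (parent y == x))].

Fact rooted_sym : symmetric rooted_edge.
Proof. by move=> x y; rewrite /rooted_edge /= eq_sym orbC. Qed.

Fact rooted_irrefl : irreflexive rooted_edge.
Proof. by move=> x; rewrite /rooted_edge /= eqxx. Qed.

Definition rooted_graph : sgraph := SGraph rooted_sym rooted_irrefl.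

Lemma rooted_edge_parent x y : rooted_edge x y -> rank y <= rank x -> parent x = y.
Proof.
case/andP=> nxy /orP[/eqP->//|/eqP pyx] le_yx; have [y0|/rank_parent] := eqVneq y root.
  by move: nxy; rewrite -pyx y0 parent_root eqxx.
by rewrite pyx ltnNge le_yx.
Qed.

Lemma edge_parent x : x != root -> rooted_edge x (parent x).
Proof.
move=> nx; rewrite /rooted_edge /= eqxx orTb andbT; apply: contraTneq (rank_parent nx) => <-.
by rewrite ltnn.
Qed.

(* In a cycle, both neighbours of a node of maximal rank are its parent. *)
Lemma rooted_tree : is_tree rooted_graph.
Proof.
split.
  have conn_root x : connect rooted_edge x root.
    have [n] := ubnP (rank x); elim: n x => // n IHn x; rewrite ltnS => le_xn.
    have [->|nx] := eqVneq x root; first exact: connect0.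
    apply: connect_trans (connect1 (edge_parent nx)) (IHn _ _).
    exact: leq_trans (rank_parent nx) le_xn.
  split; first by apply/card_gt0P; exists root.
  move=> u v; apply: connect_trans (conn_root u) _.
  rewrite (sym_connect_sym rooted_sym); exact: conn_root.
move=> c sz_c /andP[cyc_c uniq_c].
have [x xc max_x] : exists2 x, x \in c & {in c, forall y, rank y <= rank x}.
  case: c sz_c {cyc_c uniq_c} => // z c _.
  case: (@arg_maxnP _ z (mem (z :: c)) rank); first exact: mem_head.
  by move=> x xc max_x; exists x.
(* After rotation to [x], its two neighbours on the cycle are the second and the last node, distinct
   since the length exceeds 2. *)
case/rot_to: (xc) => i c' rot_c.
have sub_c' : {subset x :: c' <= c} by move=> y; rewrite -rot_c mem_rot.
move: cyc_c uniq_c sz_c; rewrite -(rot_cycle i) -(rot_uniq i) -(size_rot i) rot_c.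
case: c' {rot_c} sub_c' => [|a [|b c']] // sub_c' cyc_c /and3P[_ + _] _.
have px y : y \in [:: x, a, b & c'] -> rooted_edge x y -> parent x = y.
  by move=> yc xy; apply: rooted_edge_parent xy _; apply: max_x; apply: sub_c'.
move: cyc_c; rewrite /cycle rcons_path => /andP[/andP[xa _]]; rewrite edge_sym => xl.
have pxa : parent x = a by apply: px; rewrite ?inE ?eqxx ?orbT.
have pxl : parent x = last b c' by apply: px; rewrite // !(in_cons x, in_cons a) mem_last !orbT.
by rewrite -pxa pxl mem_last.
Qed.
End RootedTree.

Section RootedDecomposition.
Variables (G : sgraph) (T : finType) (parent : T -> T) (rank : T -> nat) (root : T).
Hypothesis parent_root : parent root = root.
Hypothesis rank_parent : forall x, x != root -> rank (parent x) < rank x.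
Variables (X : T -> {set G}) (top : G -> T).
Hypothesis edge_X : forall u v : G, edge u v -> exists t, (u \in X t) && (v \in X t).
Hypothesis top_X : forall v, v \in X (top v).
Hypothesis parent_X : forall v t, v \in X t -> t != top v ->
  (t != root) && (v \in X (parent t)).

(** Climbing along [parent] from any node whose bag contains [v] stays among such nodes until
    [top v] is reached. *)
Fact rooted_bag_connected v :
  is_connected (Defs.induced [set t : rooted_graph parent | v \in X t]).
Proof.
apply/is_connected_induced; split; first by exists (top v); rewrite inE.
set A := [set _ | _]; have sym_A := rel_within_connect_sym (mem A) (rooted_sym parent).
suff to_top t : v \in X t -> connect (rel_within (rooted_edge parent) (mem A)) t (top v).
  move=> s t; rewrite !inE => vs vt; apply: connect_trans (to_top s vs) _.
  by rewrite sym_A to_top.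
have [n] := ubnP (rank t); elim: n t => // n IHn t; rewrite ltnS => le_tn vt.
have [->|nt] := eqVneq t (top v); first exact: connect0.
have /andP[t_root vpt] := parent_X vt nt.
apply: (connect_trans (y := parent t)).
  by apply: connect1; rewrite /rel_within /= !inE vt vpt (edge_parent rank_parent t_root).
exact: IHn (leq_trans (rank_parent t_root) le_tn) vpt.
Qed.

Definition rooted_decomposition : tree_decomposition G :=
  TreeDecomposition (rooted_tree parent_root rank_parent) edge_X rooted_bag_connected.
End RootedDecomposition.

(** * Brambles and the bags that meet them *)

Definition cut (T : sgraph) (s t : T) : rel T :=
  [rel x y | edge x y && ([set x; y] != [set s; t])].

Lemma cut_sym (T : sgraph) (s t : T) : symmetric (cut s t).
Proof. by move=> x y; rewrite /cut /= edge_sym finset.setUC. Qed.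

(** A simple path from [s] to [t] avoiding the edge would close up with it to a cycle. *)
Lemma tree_cut (T : sgraph) (s t : T) :
  is_tree T -> edge s t -> ~~ connect (cut s t) s t.
Proof.
move=> [_ acyclic_T] st; apply/negP => /connectP[p0 /shortenP[p path_p uniq_p _] last_p].
case: p path_p uniq_p last_p => [|a [|b p]] path_p uniq_p last_p.
- by rewrite /= in last_p; rewrite last_p edge_irrefl in st.
- by rewrite /= in last_p; move: path_p; rewrite /cut /= last_p eqxx andbF.
apply: (acyclic_T [:: s, a, b & p]) => //; rewrite /ucycle uniq_p andbT.
rewrite /cycle rcons_path; apply/andP; split; last by rewrite edge_sym -last_p.
by apply: sub_path path_p => x y /andP[].
Qed.

Section Bramble.
Variables (G : sgraph) (D : tree_decomposition G) (I : finType).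
Variables (B : I -> {set G}) (hub : I -> G).
Hypothesis hub_B : forall i, hub i \in B i.
Hypothesis B_hub : forall i u, u \in B i ->
  connect (rel_within edge (mem (B i))) u (hub i).
Hypothesis touch_B : forall i j,
  exists u v, [&& u \in B i, v \in B j & (u == v) || edge u v].

(** The bags meeting the connected set [B i] span a subtree, which avoids [t] if the bag of [t]
    misses [B i]. *)
Lemma bag_within_connect (t : D) i : [disjoint B i & bag t] ->
  {in B i &, forall u v r s, u \in bag r -> v \in bag s ->
    connect (rel_within edge (mem [set~ t])) r s}.
Proof.
move=> dis_t; set e := rel_within _ _.
have sym_e : connect_sym e by apply: rel_within_connect_sym; exact: edge_sym.
have same_vertex u r s : u \in B i -> u \in bag r -> u \in bag s -> connect e r s.
  move=> Bu ur us; have [_] := (is_connected_induced _).1 (bag_connected D u).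
  move=> /(_ r s); rewrite !inE => /(_ ur us).
  apply: connect_sub => x y /and3P[]; rewrite !inE => ux uy xy; apply: connect1.
  have nt z : u \in bag z -> z != t.
    by apply: contraTneq => ->; rewrite (disjointFr dis_t).
  by rewrite /e /rel_within /= !inE xy !nt.
have in_some_bag u : exists r : D, u \in bag r.
  have [[r]] := (is_connected_induced _).1 (bag_connected D u).
  by rewrite inE; exists r.
suff to_hub u r s : u \in B i -> u \in bag r -> hub i \in bag s -> connect e r s.
  move=> u v Bu Bv r s ur vs; have [q hq] := in_some_bag (hub i).
  apply: connect_trans (to_hub _ _ _ Bu ur hq) _.
  by rewrite sym_e (to_hub _ _ _ Bv vs hq).
move=> Bu ur hs; have /connectP[p path_p hub_p] := B_hub Bu.
elim: p u Bu r ur path_p hub_p => [|w p IHp] u Bu r ur /=.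
  by move=> _ hub_u; apply: same_vertex Bu ur _; rewrite -hub_u.
case/andP=> /and3P[_ Bw uw] path_p hub_p.
have [q /andP[uq wq]] := bag_edge D uw.
exact: connect_trans (same_vertex _ _ _ Bu ur uq) (IHp w Bw q wq path_p hub_p).
Qed.

(* If every bag missed some element of the bramble, each node could be sent to
   the neighbour in the direction of an element that its bag misses. This map has
   a cycle: one of length at least 3 contradicts acyclicity, and one of length 2
   is an edge of the tree separating two elements of the bramble. *)
Theorem bramble_bag : exists t : D, forall i, ~~ [disjoint B i & bag t].
Proof.
have [conn_D acyclic_D] := td_tree D.
apply: contrapT => no_bag.
have /choice[m m_dis] : forall t : D, exists i, [disjoint B i & bag t].
  move=> t; apply: contrapT => hit; apply: no_bag; exists t => i.
  by apply/negP => dis_i; apply: hit; exists i.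
have /choice[g gP] : forall t : D, exists s : D, edge t s /\
    forall u r, u \in B (m t) -> u \in bag r -> connect (cut t s) s r.
  move=> t.
  have [[q]] := (is_connected_induced _).1 (bag_connected D (hub (m t))).
  rewrite inE => hq _.
  have ntq : t != q.
    by apply: contraTneq hq => <-; rewrite (disjointFr (m_dis t)).
  have /connectP[p0 /shortenP[p path_p uniq_p _] last_p] := conn_D.2 t q.
  case: p path_p uniq_p last_p => [|s p] /=.
    by move=> _ _ qt; rewrite qt eqxx in ntq.
  case/andP=> ts path_p /andP[nt_p _] last_p; exists s; split=> // u r Bu ur.
  have sub_cut : subrel (rel_within edge (mem [set~ t])) (cut t s).
    move=> x y /and3P[]; rewrite !inE => nx ny xy; rewrite /cut /= xy.
    apply/eqP => /finset.setP/(_ t); rewrite !inE eqxx orTb.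
    by rewrite ![t == _]eq_sym (negPf nx) (negPf ny).
  apply: (connect_trans (y := q)); last first.
    apply: connect_sub (bag_within_connect (m_dis t) (hub_B _) Bu hq ur) => x y xy.
    exact/connect1/sub_cut.
  apply/connectP; exists p => //; apply: (sub_in_path (P := predC1 t)) path_p.
    move=> x y; rewrite !inE => nx ny xy; apply: sub_cut.
    by rewrite /rel_within /= !inE nx ny.
  by apply/allP => x xp; apply: contraNneq nt_p => <-.
have [y fcycle_y] : exists y, fcycle g (orbit g y).
  have [t _] := card_gt0P conn_D.1; have /trajectP[i lt_i it] := looping_order g t.
  exists (iter i g t); apply/(orbitPcycle 0 3); exists (order g t - i).-1.
  by rewrite prednK ?subn_gt0 // -iterD subnK // ltnW.
have cycle_y : cycle edge (orbit g y).
  by apply: sub_cycle fcycle_y => a b /eqP <-; have [] := gP a.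
have [ygy _] := gP y.
case: (ltngtP (size (orbit g y)) 2) => [lt2|gt2|eq2].
- move: lt2 cycle_y (order_gt0 g y); rewrite size_orbit /orbit.
  by case: (order g y) => [|[|]] //= _; rewrite edge_irrefl.
- by apply: (acyclic_D _ gt2); rewrite /ucycle cycle_y orbit_uniq.
have ggy : g (g y) = y.
  by move/(orbitPcycle 0 4): fcycle_y; rewrite (_ : order g y = 2) // -size_orbit.
have [u [v /and3P[Bu Bv uv]]] := touch_B (m y) (m (g y)).
have [r /andP[ur vr]] : exists r : D, (u \in bag r) && (v \in bag r).
  case/orP: uv => [/eqP<-|/(bag_edge D)//].
  have [[r]] := (is_connected_induced _).1 (bag_connected D u).
  by rewrite inE; exists r; apply/andP.
(* With the edge deleted, the node [r] is still reachable from [g y], through [u], and from [y],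
   through [v]. *)
have := tree_cut (td_tree D) ygy; apply/negP/negPn.
rewrite (sym_connect_sym (cut_sym _ _)).
apply: connect_trans ((gP y).2 u r Bu ur) _.
rewrite (sym_connect_sym (cut_sym _ _)).
by have := (gP (g y)).2 v r Bv vr; rewrite ggy /cut finset.setUC.
Qed.
End Bramble.

(** * Burling graphs, built by induction *)

(* A Burling graph on [pt] with its probes, a probe [p] being identified with the
   stable set [reach p] of the points that it meets. The graph comes with a rooted
   tree decomposition whose nodes are the points themselves: [part t] is the bag of
   [t], [side t] a 2-colouring of that bag, and the bag of [leaf p] contains
   [reach p]. *)
Record probed := Probed {
  pt : finType;
  probe : finType;
  adj : rel pt;
  reach : probe -> pred pt;
  weight : pt -> nat;
  parent : pt -> pt;
  rank : pt -> nat;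
  root : pt;
  leaf : probe -> pt;
  part : pt -> pred pt;
  side : pt -> pt -> bool }.

Definition stable (T : Type) (e : rel T) (I : pred T) : Prop :=
  forall u v, I u -> I v -> ~~ e u v.

Definition hit (S : probed) (I : pred (pt S)) (p : probe S) : bool :=
  [exists v, reach p v && I v].

Record burling_spec (k : nat) (S : probed) : Prop := BurlingSpec {
  adj_sym : symmetric (@adj S);
  adj_irrefl : irreflexive (@adj S);
  reach_stable : forall p : probe S, stable (@adj S) (reach p);
  parent_root : parent (root S) = root S;
  rank_parent : forall t : pt S, t != root S -> rank (parent t) < rank t;
  part_adj : forall u v : pt S, adj u v -> exists t, part t u && part t v;
  part_top : forall v : pt S, part v v;
  part_parent : forall t v : pt S, part t v -> t != v ->
    (t != root S) && part (parent t) v;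
  part_leaf : forall (p : probe S) v, reach p v -> part (leaf p) v;
  side_adj : forall t u v : pt S, part t u -> part t v -> adj u v ->
    side t u != side t v;
  card_probe : 2 * #|probe S| = 2 ^ 2 ^ k;
  weight_total : 2 * (\sum_v @weight S v) = (k + 2) * #|probe S|;
  weight_hit : forall I, stable (@adj S) I ->
    \sum_(v | I v) weight v <= \sum_p hit I p }.

Lemma burling_base : exists S, burling_spec 0 S.
Proof.
exists (@Probed unit unit (fun _ _ => false) (fun _ => predT) (fun _ => 1) id
  (fun _ => 0) tt id (fun _ => predT) (fun _ _ => false)).
split=> //=.
- by rewrite card_unit.
- by rewrite sum1_card !card_unit.
move=> I _; rewrite big_mkcond; apply: leq_sum => u _; case: ifP => // Iu.
by rewrite lt0b; apply/existsP; exists u.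
Qed.

(* A copy of [S] is inserted below every probe [p] of [S]: [inl v] is a point of the
   outer copy, [inr (p, inl v)] one of the copy below [p], and [inr (p, inr q)] a new
   point adjacent to what the probe [q] of that copy meets. The new probe
   [(p, q, b)] follows [p], then either crosses the inner copy along [q] or, when
   [b], avoids it and meets the new point. *)
Section Step.
Variable S : probed.
Local Notation V := (pt S).
Local Notation P := (probe S).
Local Notation V' := (V + P * (V + P))%type.
Local Notation P' := (P * P * bool)%type.

Definition step_adj (x y : V') : bool :=
  match x, y with
  | inl u, inl v => adj u v
  | inr (p, inl u), inr (p', inl v) => (p == p') && adj u v
  | inr (p, inl u), inr (p', inr q) => (p == p') && reach q u
  | inr (p, inr q), inr (p', inl v) => (p == p') && reach q v
  | _, _ => false
  end.

Definition step_reach (r : P') (x : V') : bool :=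
  let: (p, q, b) := r in
  match x with
  | inl v => reach p v
  | inr (p', inl v) => [&& p' == p, ~~ b & reach q v]
  | inr (p', inr q') => [&& p' == p, q' == q & b]
  end.

(** With n probes and total weight w, the step yields 2n^2 probes and total weight 2nw + n^2, so
    that the ratio of weight to probes grows by 1/2. *)
Definition step_weight (x : V') : nat :=
  match x with
  | inl v => #|P| * weight v
  | inr (_, inl v) => weight v
  | inr (_, inr _) => 1
  end.

Definition step_parent (x : V') : V' :=
  match x with
  | inl v => inl (parent v)
  | inr (p, inl v) => if v == root S then inl (leaf p) else inr (p, inl (parent v))
  | inr (p, inr q) => inr (p, inl (leaf q))
  end.

Definition step_rank (x : V') : nat :=
  match x with
  | inl v => rank v
  | inr (p, inl v) => (rank (leaf p) + rank v).+1
  | inr (p, inr q) => (rank (leaf p) + rank (leaf q)).+2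
  end.

(** Every bag below [p] also carries [reach p], so that the new leaves contain what the new probes
    meet. As the inner tree hangs from [leaf p], the nodes of an outer point stay connected. *)
Definition step_part (t x : V') : bool :=
  match t, x with
  | inl t, inl v => part t v
  | inr (p, _), inl v => reach p v
  | inr (p, inl t), inr (p', inl v) => (p' == p) && part t v
  | inr (p, inr q), inr (p', inl v) => (p' == p) && reach q v
  | inr (p, inr q), inr (p', inr q') => (p' == p) && (q' == q)
  | _, _ => false
  end.

(** Below [p], all of [reach p] may receive [false]: it is stable and has no neighbour in the inner
    copy. In the bag of a new point, only that point receives [true], since [reach q] is stable
    too. *)
Definition step_side (t x : V') : bool :=
  match t, x with
  | inl t, inl v => side t v
  | inr (p, inl t), inr (_, inl v) => side t v
  | inr (p, inr _), inr (_, inr _) => true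
  | _, _ => false
  end.

Definition step : probed :=
  @Probed V' P' step_adj step_reach step_weight step_parent step_rank
    (inl (root S)) (fun r => inr (r.1.1, inr r.1.2)) step_part step_side.

Lemma sum_step (F : V' -> nat) (I : pred V') :
  \sum_(x | I x) F x = \sum_(v | I (inl v)) F (inl v) +
    \sum_p (\sum_(v | I (inr (p, inl v))) F (inr (p, inl v)) +
            \sum_(q | I (inr (p, inr q))) F (inr (p, inr q))).
Proof.
rewrite big_sumType /=; congr (_ + _).
transitivity (\sum_p \sum_(y | I (inr (p, y))) F (inr (p, y))).
  by rewrite pair_big_dep /=; apply: eq_big => [[]|[]].
by apply: eq_bigr => p _; rewrite big_sumType.
Qed.

Lemma sum_probe_step (F : P' -> nat) :
  \sum_r F r = \sum_p \sum_q (F (p, q, true) + F (p, q, false)).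
Proof.
rewrite pair_bigA; under [RHS]eq_bigr => x _.
  rewrite -(big_bool _ (fun b => F (x.1, x.2, b))); over.
by rewrite pair_bigA; apply: eq_bigr => -[[p q] b].
Qed.

Variable k : nat.
Hypothesis specS : burling_spec k S.

(* A probe [p] that is hit contributes all its [2 * #|P|] extensions. Otherwise, each
   [q] has an extension that is hit for a hit inner [q] and for a chosen new point,
   and these two cases exclude each other. *)
Lemma step_weight_hit (I : pred V') : stable step_adj I ->
  \sum_(v | I v) step_weight v <= \sum_r hit (S := step) I r.
Proof.
move=> stI.
have st0 : stable (@adj S) (fun v => I (inl v)) by move=> u v; apply: stI.
have stp p : stable (@adj S) (fun v => I (inr (p, inl v))).
  by move=> u v Iu Iv; have := stI _ _ Iu Iv; rewrite /= eqxx.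
rewrite sum_step sum_probe_step /= -big_distrr /=.
apply: leq_trans (leq_add (leq_mul (leqnn _) (weight_hit specS st0)) (leqnn _)) _.
rewrite big_distrr -big_split /=; apply: leq_sum => p _.
have le1 : \sum_(v | I (inr (p, inl v))) weight v + \sum_(q | I (inr (p, inr q))) 1
    <= \sum_q (hit (fun v => I (inr (p, inl v))) q + I (inr (p, inr q))).
  rewrite big_split /= leq_add ?(weight_hit specS (stp p)) //.
  by rewrite big_mkcond; apply: leq_sum => q _; case: ifP.
have disj q : hit (fun v => I (inr (p, inl v))) q + I (inr (p, inr q)) <= 1.
  have [/existsP[v /andP[qv Iv]]|_] := boolP (hit _ q); last by case: (I _).
  have [Iq|//] := boolP (I (inr (p, inr q))).
  by have := stI _ _ Iv Iq; rewrite /= eqxx qv.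
apply: leq_trans (leq_add (leqnn _) le1) _.
rewrite -sum_nat_const -big_split /=; apply: leq_sum => q _.
have lift_hit r x : step_reach r x -> I x -> hit (S := step) I r.
  by move=> rx Ix; apply/existsP; exists x; apply/andP.
have [/existsP[v /andP[pv Iv]]|_] := boolP (hit _ p).
  by rewrite !(lift_hit _ (inl v)) // leq_add2l (disj q).
rewrite add0n addnC leq_add //.
  case: (boolP (I _)) => // Iq.
  by rewrite (lift_hit _ (inr (p, inr q))) //= !eqxx.
case: (boolP (hit _ q)) => // /existsP[v /andP[qv Iv]].
by rewrite (lift_hit _ (inr (p, inl v))) //= eqxx.
Qed.

Lemma step_spec : burling_spec k.+1 step.
Proof.
have symS := adj_sym specS.
split=> /=.
- by case=> [u|[p [u|q]]] [v|[p' [v|q']]]; rewrite /= ?(eq_sym p p') // symS.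
- by case=> [u|[p [u|q]]] //=; rewrite (adj_irrefl specS) ?andbF.
- have stN := reach_stable specS.
  case=> [[p q] b] [u|[p1 [u|q1]]] [v|[p2 [v|q2]]] //=; first exact: stN.
    move=> /and3P[_ _ qu] /and3P[_ _ qv]; rewrite negb_and.
    by rewrite (stN _ _ _ qu qv) orbT.
  + by move=> /and3P[_ /negPf-> _] /and3P[].
  by move=> /and3P[_ _ ->] /and3P[].
- by rewrite (parent_root specS).
- case=> [t|[p [t|q]]] /= nt; first exact: (rank_parent specS).
    by case: eqVneq => [_|/(rank_parent specS)] /=; rewrite ?ltnS ?leq_addr // ltn_add2l.
  by [].
- have edge_S := part_adj specS.
  case=> [u|[p [u|q]]] [v|[p' [v|q']]] //=.
  + by case/edge_S=> t uvt; exists (inl t).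
  + by case/andP=> /eqP <- /edge_S[t uvt]; exists (inr (p, inl t)); rewrite /= eqxx.
  + by case/andP=> /eqP <- qu; exists (inr (p, inr q')); rewrite /= !eqxx qu.
  by case/andP=> /eqP <- qv; exists (inr (p, inr q)); rewrite /= !eqxx qv.
- by case=> [v|[p [v|q]]] /=; rewrite ?eqxx ?(part_top specS).
- have top_S := part_parent specS; have leaf_S := part_leaf specS.
  case=> [t|[p [t|q]]] [v|[p' [v|q']]] //=.
  + by move=> tv ntv; apply: top_S tv _; apply: contraNneq ntv => ->.
  + by move=> pv _; case: eqVneq => // _; apply: leaf_S.
  + case/andP=> /eqP -> tv ntv.
    have /andP[/negPf-> /= ->] : (t != root S) && part (parent t) v; last by rewrite eqxx.
    by apply: top_S tv _; apply: contraNneq ntv => ->.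
  + by case/andP=> /eqP -> qv _; rewrite eqxx leaf_S.
  by case/andP=> /eqP -> /eqP ->; rewrite eqxx.
- case=> [[p q] b] [v|[p' [v|q']]] //=.
    by case/and3P=> ->.
  by case/and3P=> -> ->.
- have side_S := side_adj specS.
  case=> [t|[p [t|q]]] [u|[p1 [u|q1]]] [v|[p2 [v|q2]]] //=.
  + exact: side_S.
  + by move=> pu pv uv; have := reach_stable specS pu pv; rewrite uv.
  + by case/andP=> _ tu /andP[_ tv] /andP[_]; apply: side_S.
  + by move=> pu pv uv; have := reach_stable specS pu pv; rewrite uv.
  move=> /andP[_ qu] /andP[_ qv] /andP[_ uv].
  by have := reach_stable specS qu qv; rewrite uv.
- rewrite !card_prod card_bool; transitivity (2 * #|P| * (2 * #|P|)); first by nia.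
  by rewrite (card_probe specS) -expnD addnn -mul2n -expnS.
- rewrite sum_step /= -big_distrr /= big_split /= !sum_nat_const.
  rewrite (_ : #|xpredT| = #|P|); last exact: eq_card.
  have := congr1 (muln #|P|) (weight_total specS); rewrite !card_prod card_bool.
  by move: #|P| (\sum_v _) => n w; lia.
exact: step_weight_hit.
Qed.
End Step.

Theorem burling k : exists S, burling_spec k S.
Proof.
by elim: k => [|k [S specS]]; [apply: burling_base | exists (step S); apply: step_spec].
Qed.

(** * Bounds on tree parameters and on parameters of bags *)

Lemma min_bag_max_le (G : sgraph) (w : {set G} -> nat) (D : tree_decomposition G) n :
  (forall t : D, w (bag t) <= n) -> min_bag_max w <= n.
Proof.
move=> w_n; rewrite /min_bag_max; case: ex_minnP => m _ min_m.
apply: (leq_trans (min_m (bag_max w D) _)); first by apply/asboolP; exists D.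
by apply/bigmax_leqP.
Qed.

Lemma min_bag_max_attained (G : sgraph) (w : {set G} -> nat) :
  exists D : tree_decomposition G, forall t : D, w (bag t) <= min_bag_max w.
Proof.
rewrite /min_bag_max; case: ex_minnP => m /asboolP[D <-] _; exists D => t.
exact: leq_bigmax.
Qed.

Lemma independence_induced_le (G : sgraph) (X : {set G}) n :
  (forall B : {set G}, B \subset X -> independent B -> #|B| <= n) ->
  independence_number (Defs.induced X) <= n.
Proof.
move=> B_n; apply/bigmax_leqP => A indA; rewrite -(card_imset _ val_inj); apply: B_n.
  by apply/fintype.subsetP => _ /imsetP[x _ ->]; apply: valP.
apply/forall_inP => _ /imsetP[x Ax ->]; apply/forall_inP => _ /imsetP[y Ay ->].
by move/forall_inP/(_ x Ax)/forall_inP/(_ y Ay): indA.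
Qed.

(** Colourings as [nat]-valued maps on the whole of [G] allow palettes to be shifted by addition. *)
Lemma chromatic_induced_le (G : sgraph) (X : {set G}) k :
  chromatic_number (Defs.induced X) <= k <->
  exists2 c : G -> nat, {in X, forall u, c u < k} &
    {in X &, forall u v, edge u v -> c u != c v}.
Proof.
split=> [|[c c_lt c_neq]].
  rewrite /chromatic_number; case: ex_minnP => n /existsP[c /forallP cP] _ le_nk.
  exists (fun u => if insub u is Some s then c s : nat else 0) => [u Xu|u v Xu Xv uv].
    by rewrite insubT (leq_trans (ltn_ord _)).
  by rewrite !insubT; have /forallP/(_ (Sub v Xv))/implyP := cP (Sub u Xu); apply.
rewrite /chromatic_number; case: ex_minnP => n _; apply.
apply/existsP; exists [ffun u => Ordinal (c_lt _ (valP u))].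
apply/forallP => u; apply/forallP => v; apply/implyP => uv; rewrite !ffunE.
exact: c_neq (valP u) (valP v) uv.
Qed.

(** * The star of copies of a graph *)

Section StarOfCopies.
Variable H : sgraph.

(* [inl (v, None)] is the vertex [v] of the central copy of [H], [inl (v, Some j)]
   that of the leaf copy [j], and [inr j] the hub of the leaf copy [j]. *)
Definition star_vertex : finType := ((H * option H) + H)%type.

Definition star_edge : rel star_vertex := fun x y =>
  match x, y with
  | inl (u, i), inl (v, j) =>
      (i == j) && edge u v || (u == v) && (isSome i (+) isSome j)
  | inl (_, i), inr j | inr j, inl (_, i) => i == Some j
  | inr _, inr _ => false
  end.

Fact star_sym : symmetric star_edge.
Proof.
move=> [[u i]|j] [[v i']|j'] //=.
by rewrite edge_sym addbC [i == _]eq_sym [u == _]eq_sym.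
Qed.

Fact star_irrefl : irreflexive star_edge.
Proof. by move=> [[u i]|j] //=; rewrite edge_irrefl addbb !andbF. Qed.

Definition star_of_copies : sgraph := SGraph star_sym star_irrefl.

(** The central copy takes one palette; the leaf copies, mutually non-adjacent, share a second one;
    the hubs, also mutually non-adjacent, share one last colour. *)
Lemma star_tree_chi : tree_chi star_of_copies <= 2 * tree_chi H + 1.
Proof.
have [D chi_D] := min_bag_max_attained (fun X : {set H} => chromatic_number (Defs.induced X)).
rewrite -/(tree_chi H) in chi_D.
pose X (t : D) : {set star_of_copies} :=
  [set x | if x is inl (v, _) then v \in bag t else true].
have X_edge (x y : star_of_copies) : edge x y -> exists t, (x \in X t) && (y \in X t).
  have in_bag v : exists t : D, v \in bag t.
    have [[t]] := (is_connected_induced _).1 (bag_connected D v).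
    by rewrite inE; exists t.
  case: x y => [[u i]|j] [[v i']|j'] //= => [/orP[/andP[_]|/andP[/eqP<- _]]|_|_].
  - by move=> /(bag_edge D)[t uvt]; exists t; rewrite !inE.
  - by have [t ut] := in_bag u; exists t; rewrite !inE ut.
  - by have [t ut] := in_bag u; exists t; rewrite !inE ut.
  by have [t ut] := in_bag v; exists t; rewrite !inE ut.
have X_connected (x : star_of_copies) : is_connected (Defs.induced [set t | x \in X t]).
  case: x => [[v i]|j].
    rewrite (_ : [set _ | _] = [set t | v \in bag t]); first exact: bag_connected.
    by apply/finset.setP => t; rewrite !inE.
  have [/card_gt0P[t0 _] conn_D] := (td_tree D).1.
  apply/is_connected_induced; split; first by exists t0; rewrite !inE.
  move=> s t _ _; apply: connect_sub (conn_D s t) => a b ab; apply: connect1.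
  by rewrite /rel_within /= !inE.
apply: (min_bag_max_le (D := TreeDecomposition (td_tree D) X_edge X_connected)) => t.
have /chromatic_induced_le[c c_lt c_neq] := chi_D t.
set k := tree_chi H in c_lt *.
apply/chromatic_induced_le.
exists (fun x : star_of_copies => match x with
  | inl (v, None) => c v | inl (v, Some _) => k + c v | inr _ => 2 * k end).
  by case=> [[v [i|]]|j]; rewrite !inE /=; [move/c_lt|move/c_lt|move=> _]; lia.
case=> [[u [i|]]|j] [[v [i'|]]|j'] //=; rewrite !inE => Xu Xv.
- rewrite andbF orbF => /andP[_ /c_neq]; rewrite eqn_add2l; exact.
- by move=> _; have := c_lt _ Xv; lia.
- by move=> _; have := c_lt _ Xu; lia.
- by move=> _; have := c_lt _ Xu; lia.
- rewrite andbF orbF => /c_neq; exact.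
by move=> _; have := c_lt _ Xv; lia.
Qed.

(** The decomposition tree is a star centred at [None]. An independent set in the bag of [t] splits
    into a part in the central copy, a part in copy [t] and at most one hub. *)
Lemma star_tree_alpha : tree_alpha star_of_copies <= 2 * independence_number H + 1.
Proof.
pose X (t : option H) : {set star_of_copies} := [set x | match x with
  | inl (_, i) => (i == None) || (i == t) | inr j => Some j == t end].
pose top (x : star_of_copies) := match x with inl (_, i) => i | inr j => Some j end.
pose par (t : option H) : option H := None.
have rank_par (t : option H) : t != None -> isSome (par t) < isSome t by case: t.
have X_edge (x y : star_of_copies) : edge x y -> exists t, (x \in X t) && (y \in X t).
  case: x y => [[u i]|j] [[v i']|j'] //= => [/orP[/andP[/eqP<- _]|/andP[_]]|/eqP->|/eqP->].
  - by exists i; rewrite !inE eqxx orbT.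
  - by case: i i' => [i|] [i'|] //= _; [exists (Some i)|exists (Some i')]; rewrite !inE !eqxx.
  - by exists (Some j'); rewrite !inE !eqxx.
  by exists (Some j); rewrite !inE !eqxx.
have X_top x : x \in X (top x) by case: x => [[u i]|j]; rewrite !inE eqxx ?orbT.
have X_par x t : x \in X t -> t != top x -> (t != None) && (x \in X (par t)).
  by case: x t => [[u [i|]]|j] [t|]; rewrite !inE //= eq_sym => -> //.
apply: (min_bag_max_le (D := rooted_decomposition (erefl : par None = None) rank_par
  X_edge X_top X_par)) => t.
apply: independence_induced_le => B /fintype.subsetP BX indB.
pose slice i := [set v | inl (v, i) \in B].
pose copy i v : star_of_copies := inl (v, i).
pose hub j : star_of_copies := inr j.
have slice_le i : #|copy i @: slice i| <= independence_number H.
  apply: leq_trans (leq_imset_card _ _) _; apply: leq_bigmax_cond.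
  apply/forall_inP => u; rewrite inE => Bu; apply/forall_inP => v; rewrite inE => Bv.
  move/forall_inP/(_ _ Bu)/forall_inP/(_ _ Bv): indB; apply: contra => uv.
  by rewrite /edge /= eqxx uv.
have hub_le : #|hub @: [pred j | Some j == t]| <= 1.
  apply: leq_trans (leq_imset_card _ _) _; apply/card_le1P => i; rewrite !inE => /eqP <- j.
  by rewrite !inE (inj_eq (@Some_inj _)).
rewrite mul2n -addnn; apply: leq_trans (leq_add (leq_add (slice_le None) (slice_le t)) hub_le).
apply: leq_trans (leq_add (leq_card_setU _ _) (leqnn _)).
apply: leq_trans (leq_card_setU _ _); apply/subset_leq_card/fintype.subsetP => x Bx.
have := BX x Bx; rewrite !inE; case: x Bx => [[v i]|j] Bx.
  by case/orP=> /eqP i_eq; rewrite i_eq in Bx *;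
    rewrite (imset_f (copy _)) ?orbT // inE.
by move=> jt; rewrite (imset_f hub) ?orbT.
Qed.

(* The bramble consists of the sets formed by a vertex of the central copy, a leaf
   copy and its hub. A set meeting all of them contains the central copy or meets
   every leaf copy together with its hub. *)
Lemma star_treewidth : (#|H|%:Z - 1 <= treewidth star_of_copies)%R.
Proof.
rewrite lerB // lez_nat.
have [D tw_D] := min_bag_max_attained (fun X : {set star_of_copies} => #|X|).
pose B (i : H * H) : {set star_of_copies} := [set x | match x with
  | inl (v, None) => v == i.1 | inl (_, Some j) => j == i.2 | inr j => j == i.2 end].
have hub_B i : inr i.2 \in B i by rewrite inE.
have B_hub i u : u \in B i -> connect (rel_within edge (mem (B i))) u (inr i.2).
  case: i => x j; rewrite inE; case: u => [[v [i|]]|i] /= /eqP ->; last exact: connect0.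
    by apply: connect1; rewrite /rel_within /= !inE !eqxx.
  apply: (connect_trans (y := inl (x, Some j))); apply: connect1;
    by rewrite /rel_within /= !inE /edge /= !eqxx ?orbT.
have touch_B i j : exists u v, [&& u \in B i, v \in B j & (u == v) || edge u v].
  exists (inl (i.1, None)), (inl (i.1, Some j.2)).
  by rewrite !inE !eqxx /edge /= eqxx orbT.
have [t hit_t] := bramble_bag D hub_B B_hub touch_B.
apply: leq_trans (tw_D t).
have [all_central|] := boolP [forall v, inl (v, None) \in bag t].
  have inj : injective (fun v : H => inl (v, None) : star_of_copies) by move=> u v [].
  rewrite -(card_imset _ inj); apply/subset_leq_card/fintype.subsetP => _ /imsetP[v _ ->].
  exact: (forallP all_central).
case/forallPn => x xt.
pose leaf_of (y : star_of_copies) := match y with inl (_, i) => i | inr j => Some j end.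
have inj : injective (@Some H) by exact: Some_inj.
rewrite -(card_imset _ inj); apply: leq_trans (leq_imset_card leaf_of _).
apply/subset_leq_card/fintype.subsetP => _ /imsetP[j _ ->].
have /pred0Pn[y /= /andP[]] := hit_t (x, j).
rewrite inE => By yt; apply/imsetP; exists y => //.
by case: y By yt => [[v [i|]]|i] /= /eqP -> //; rewrite (negPf xt).
Qed.
End StarOfCopies.

(** * Blowing up a weighted graph *)

Section BlowUp.
Variables (k : nat) (S : probed).
Hypothesis specS : burling_spec k S.

Definition blowup_vertex : finType := {v : pt S & 'I_(weight v)}.

Definition blowup_edge : rel blowup_vertex := fun x y => adj (tag x) (tag y).

Fact blowup_sym : symmetric blowup_edge.
Proof. by move=> x y; apply: adj_sym specS _ _. Qed.

Fact blowup_irrefl : irreflexive blowup_edge.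
Proof. by move=> x; apply: adj_irrefl specS _. Qed.

Definition blowup : sgraph := SGraph blowup_sym blowup_irrefl.

Lemma sum_blowup (I : pred (pt S)) :
  #|[pred x : blowup | I (tag x)]| = \sum_(v | I v) weight v.
Proof.
rewrite -sum1_card; under [RHS]eq_bigr => v _ do rewrite -[weight v]card_ord -sum1_card.
by rewrite sig_big_dep; apply: eq_bigl => x; rewrite !inE andbT.
Qed.

Lemma card_blowup : 4 * #|blowup| = (k + 2) * 2 ^ 2 ^ k.
Proof.
have -> : #|blowup| = \sum_(v : pt S) weight v.
  by rewrite -(sum_blowup predT); apply: eq_card.
rewrite -(card_probe specS) (mulnCA (k + 2)) -(weight_total specS); lia.
Qed.

(** An independent set lies among all copies of the points it touches; their number is the weight of
    a stable set, hence at most the number of probes. *)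
Lemma independence_blowup : 2 * independence_number blowup <= 2 ^ 2 ^ k.
Proof.
rewrite -(card_probe specS) leq_mul2l /=; apply/bigmax_leqP => A indA.
pose I v := [exists x in A, tag x == v].
apply: (@leq_trans #|[pred x : blowup | I (tag x)]|).
  by apply/subset_leq_card/fintype.subsetP => x Ax; apply/exists_inP; exists x.
rewrite sum_blowup; apply: leq_trans (weight_hit specS _) _.
  move=> u v /exists_inP[x Ax /eqP <-] /exists_inP[y Ay /eqP <-].
  by move/forall_inP/(_ _ Ax)/forall_inP/(_ _ Ay): indA.
rewrite -[#|_|]sum1_card; apply: leq_sum => p _; exact: leq_b1.
Qed.

Lemma blowup_tree_chi : tree_chi blowup <= 2.
Proof.
pose X (t : pt S) : {set blowup} := [set x | part t (tag x)].
have X_edge (x y : blowup) : edge x y -> exists t, (x \in X t) && (y \in X t).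
  by case/(part_adj specS) => t xyt; exists t; rewrite !inE.
have X_top x : x \in X (tag x) by rewrite inE (part_top specS).
have X_parent x t : x \in X t -> t != tag x -> (t != root S) && (x \in X (parent t)).
  by rewrite !inE; apply: part_parent specS _ _.
apply: (min_bag_max_le (D := rooted_decomposition (parent_root specS)
  (rank_parent specS) X_edge X_top X_parent)) => t.
apply/chromatic_induced_le; exists (fun x : blowup => side t (tag x) : nat).
  by move=> x _; case: (side _ _).
move=> x y; rewrite !inE => Xx Xy /(side_adj specS Xx Xy).
by case: (side _ _); case: (side _ _).
Qed.
End BlowUp.

(** * Logarithmic estimates and the choice of parameters *)

Local Open Scope ring_scope.

Lemma ln_expr2_le (R : realType) (n : nat) : ln (2 ^+ n : R) <= n%:R.
Proof.
have ln2 : ln 2 <= 1 :> R.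
  by rewrite -[X in ln X](_ : 1 + 1 = 2 :> R) // le_ln1Dx // (lt_trans _ ltr01) ?ltrN10.
by rewrite lnXn // -[leLHS]mulr_natl ler_piMr.
Qed.

(** The argument is at most 2^(2^k + 1), so its logarithm is at most 2^k + 1, hence at most 2^(k +
    1). *)
Lemma lnln_bound (R : realType) (k : nat) :
  1 <= ln ((2 ^ 2 ^ k + 1)%:R : R) ->
  ln (ln ((2 ^ 2 ^ k + 1)%:R : R)) <= (k + 1)%:R.
Proof.
move=> ln_ge1; apply: le_trans (ln_expr2_le _ _).
rewrite ler_ln ?posrE ?exprn_gt0 ?(lt_le_trans ltr01 ln_ge1) //.
have le_2k : (2 ^ k + 1 <= 2 ^ (k + 1))%N by rewrite !addn1 expnS; have := expn_gt0 2 k; lia.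
apply: (@le_trans _ _ (ln (2 ^+ (2 ^ k + 1)%N : R))); last first.
  by apply: le_trans (ln_expr2_le _ _) _; rewrite -natrX ler_nat.
rewrite ler_ln ?posrE ?exprn_gt0 ?ltr0n ?addn1 //.
rewrite -natrX ler_nat expnS; have := expn_gt0 2 (2 ^ k); lia.
Qed.

Theorem theorem1p2 (R : realType) (f h : R -> R)
    (f_gt0 : forall x : R, 0 < f x)
    (h_gt0 : forall x : R, 0 < h x)
    (h_nondecreasing : {homo h : x y / x <= y})
    (h_littleo : h =o_ (+oo_R) (fun x : R => x * ln (ln x))) :
  exists G : sgraph,
    h (tree_alpha G)%:R * f (tree_chi G)%:R < (treewidth G)%:~R.
Proof.
(* [tree_chi G] will be at most 5 whatever [k] is, so this bound on [f] can be fixed before [k]. *)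
pose F := \sum_(i < 6) f i%:R.
have f_le i : (i <= 5)%N -> f i%:R <= F.
  move=> i5; rewrite /F (bigD1 (inord i)) //= inordK ?ltnS // lerDl.
  by apply: sumr_ge0 => j _; apply: ltW.
have F_gt0 : 0 < F := lt_le_trans (f_gt0 _) (f_le 0%N isT).
(* This constant brings the product down to [x * (k + 1) / 16], against (k + 2) E / 4 for [#|H|];
   the gap absorbs the 1 added in [x] and the 1 subtracted in the treewidth. *)
have [|M [_ h_le]] := (eqoP _ _ _).1 h_littleo (16 * F)^-1.
  by rewrite invr_gt0 mulr_gt0.
(* [x] must exceed the threshold [M] and also e, so that [ln (ln x)] is non-negative; the successor
   ensures that [k] is positive. *)
pose k := (Num.bound (`|M| + expR 1)).+1.
pose E := (2 ^ 2 ^ k)%N; pose x : R := (E + 1)%:R.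
have lt_kE : (k < E)%N by apply: ltn_trans (ltn_expl _ _) (ltn_expl _ _).
have Mx : `|M| + expR 1 < x.
  apply: lt_le_trans (archi_boundP (addr_ge0 (normr_ge0 M) (expR_ge0 1))) _.
  by rewrite ler_nat addn1; apply: leqW (ltnW (ltnW lt_kE)).
have [S specS] := burling k; pose H := blowup specS; exists (star_of_copies H).
set G := star_of_copies H.
have chi_G : (tree_chi G <= 5)%N.
  apply: leq_trans (star_tree_chi H) _; have := blowup_tree_chi specS; rewrite -/H; lia.
have alpha_G : (tree_alpha G <= E + 1)%N.
  apply: leq_trans (star_tree_alpha H) _; rewrite leq_add2r; exact: independence_blowup.
have cardH : (4 * #|H| = (k + 2) * E)%N by exact: card_blowup.
have x_gt0 : 0 < x by rewrite ltr0n addn1.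
have M_lt : M < x.
  by apply: le_lt_trans (ler_norm M) _; apply: le_lt_trans Mx; rewrite lerDl expR_ge0.
have e_lt : expR 1 < x by apply: le_lt_trans Mx; rewrite lerDr.
have ln_x : 1 <= ln x by rewrite -[leLHS]expRK ler_ln ?posrE ?expR_gt0 // ltW.
have lnln_x0 : 0 <= ln (ln x) by apply: ln_ge0.
have hx : h x <= (16 * F)^-1 * (x * (k + 1)%:R).
  apply: le_trans (ler_norm _) _; apply: le_trans (h_le x M_lt) _.
  rewrite ler_pM2l ?invr_gt0 ?mulr_gt0 // ger0_norm ?mulr_ge0 // ?(ltW x_gt0) //.
  by rewrite ler_pM2l //; apply: lnln_bound.
have tw_G : #|H|%:R - 1 <= (treewidth G)%:~R :> R.
  by have := star_treewidth H; rewrite -(ler_int R) rmorphB /= rmorph1; apply.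
apply: (lt_le_trans _ tw_G).
have hG : h (tree_alpha G)%:R <= h x by apply: h_nondecreasing; rewrite ler_nat.
apply: le_lt_trans (ler_pM (ltW (h_gt0 _)) (ltW (f_gt0 _)) (le_trans hG hx) (f_le _ chi_G)) _.
rewrite (_ : (16 * F)^-1 * _ * F = x * (k + 1)%:R / 16); last first.
  by field; rewrite lt0r_neq0.
have : 4 * #|H|%:R = (k + 2)%:R * E%:R :> R by rewrite -!natrM cardH.
have : 1 * E%:R <= k%:R * E%:R :> R.
  by rewrite ler_pM2r ?ler1n // ltr0n expn_gt0.
have : 2 <= E%:R :> R by rewrite ler_nat; apply: leq_trans lt_kE.
rewrite /x !natrD; nra.
Qed.
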